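(* Let $1\le k\le n$. If two $k$-subsets $I$ and $J$ of $[1\dots n]$ are weakly separated, then $g(I)$ and $g(J)$ are weakly separated for any $g\in D_n$.
   Context: Notation: $[1\dots n]=\{1,\dots,n\}$; $X-Y$ is set difference. For sets of integers write $X\prec Y$ if $x<y$ for all $x\in X$, $y\in Y$ (vacuously true if one is empty). Two $k$-subsets $I,J$ of $[1\dots n]$ are weakly separated if at least one of the following holds: (1) $J-I$ can be partitioned as $J'\sqcup J''$ with $J'\prec I-J\prec J''$; (2) $I-J$ can be partitioned as $I'\sqcup I''$ with $I'\prec J-I\prec I''$. (Parts may be empty.) $D_n$ is the dihedral group, realized as the group of symmetries of the regular $n$-gon whose vertices are labeled counter-clockwise by $1,\dots,n$; thus $D_n$ acts by permutations on $[1\dots n]$ and hence on $k$-subsets of $[1\dots n]$. *)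

(* Defs.v *)
(* World: MathComp with MathComp-Analysis. *)
From mathcomp Require Import all_boot all_order all_algebra all_fingroup.
From mathcomp Require Import boolp reals trigo.
From mathcomp.real_closed Require Import complex.

Set Implicit Arguments.
Unset Strict Implicit.
Unset Printing Implicit Defensive.

Import Order.TTheory GRing.Theory Num.Theory ComplexField.

(* The labels 1, ..., n are encoded, in the same order, as the elements
   0, ..., n-1 of 'I_n: the label i + 1 corresponds to i : 'I_n. *)

Definition precedes (n : nat) (X Y : {set 'I_n}) : Prop :=
  forall x y : 'I_n, x \in X -> y \in Y -> x < y.

(* A = A' \sqcup A'' with A' before B before A''; A' and A'' may be empty. *)
Definition surrounds (n : nat) (A B : {set 'I_n}) : Prop :=
  exists A' A'' : {set 'I_n},
    [/\ A = A' :|: A'', [disjoint A' & A''], precedes A' B & precedes B A''].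

Definition weakly_separated (n : nat) (I J : {set 'I_n}) : Prop :=
  surrounds (J :\: I) (I :\: J) \/ surrounds (I :\: J) (J :\: I).

Section Dihedral.
Local Open Scope ring_scope.
Local Open Scope complex_scope.

(* The Euclidean plane is R[i], whose norm is the complex modulus. *)
Definition plane_isometry (R : realType) (f : R[i] -> R[i]) : Prop :=
  forall z w : R[i], `|f z - f w| = `|z - w|.

(* exp(2 pi i j / n): increasing j runs counter-clockwise. *)
Definition ngon_vertex (R : realType) (n : nat) (j : 'I_n) : R[i] :=
  let t : R := 2 * pi * j%:R / n%:R in cos t +i* sin t.

(* The permutations of the vertex labels induced by the isometries of the
   plane that map the regular n-gon to itself. *)
Definition dihedral (R : realType) (n : nat) : {set 'S_n} :=
  [set s : 'S_n | `[< exists2 f : R[i] -> R[i], plane_isometry f &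
     forall j : 'I_n, f (ngon_vertex R j) = ngon_vertex R (s j) >]].

Lemma dihedral_group_set (R : realType) (n : nat) : group_set (dihedral R n).
Proof.
apply/group_setP; split=> [|s t]; rewrite !inE.
  by apply/asboolP; exists id => // j; rewrite perm1.
move=> /asboolP[f fI fs] /asboolP[h hI ht]; apply/asboolP.
by exists (h \o f) => [z w|j] /=; rewrite ?hI ?fI // fs ht permM.
Qed.

Canonical dihedral_group (R : realType) (n : nat) : {group 'S_n} :=
  Group (dihedral_group_set R n).

End Dihedral.

(* Main.v *)
(** Write [|xy|] for the distance between the vertices labelled [x] and [y].
    Ptolemy's equality [|ac| |bd| = |ab| |cd| + |bc| |da|] for four vertices of
    the n-gon characterizes the crossing of the chords [ac] and [bd]. Weak
    separation of [I] and [J] says that no chord with both ends in [I - J]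
    crosses a chord with both ends in [J - I], so it is expressed by distances
    alone and is therefore invariant under isometries. *)
Require Import Defs.
From mathcomp Require Import all_boot all_order all_algebra all_fingroup.
From mathcomp Require Import reals.
From mathcomp Require Import boolp trigo zify ring lra.
From mathcomp.real_closed Require Import complex.

Set Implicit Arguments.
Unset Strict Implicit.
Unset Printing Implicit Defensive.

Import Order.TTheory GRing.Theory Num.Theory ComplexField.

Section Chords.
Local Open Scope ring_scope.
Variables (R : realType) (n : nat).
Implicit Types i j x y z w a b c d : 'I_n.

Definition chord i j : R := Normc.normc (ngon_vertex R i - ngon_vertex R j).

Lemma chordC i j : chord i j = chord j i.
Proof.
rewrite /chord; case: ngon_vertex => u v; case: ngon_vertex => u' v' /=.
by rewrite -(sqrrN (u - u')) -(sqrrN (v - v')) !opprB.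
Qed.

Definition half_angle i : R := pi * i%:R / n%:R.

Lemma half_angle_sub_itv i j : (i < j)%N ->
  0 < half_angle j - half_angle i < pi.
Proof.
move=> ltij; have n_gt0 : (0 < n)%N by have := ltn_ord j; lia.
have -> : half_angle j - half_angle i = pi * ((j - i)%N%:R / n%:R).
  by rewrite /half_angle natrB 1?ltnW // mulrBl mulrBr !mulrA.
rewrite mulr_gt0 ?pi_gt0 ?divr_gt0 ?ltr0n ?subn_gt0 //=.
rewrite gtr_pMr ?pi_gt0 // ltr_pdivrMr ?ltr0n // mul1r ltr_nat.
have := ltn_ord j; lia.
Qed.

Lemma chordE i j : (i <= j)%N ->
  chord i j = 2 * sin (half_angle j - half_angle i).
Proof.
move=> leij; set t := half_angle j - half_angle i.
have t_ge0 : 0 <= sin t.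
  move: leij; rewrite leq_eqVlt => /predU1P[/val_inj eqij|/half_angle_sub_itv].
    by rewrite /t eqij subrr sin0.
  by move=> /andP[t0 tpi]; rewrite ltW // sin_gt0_pi // t0 tpi.
have double k : 2 * pi * (k : 'I_n)%:R / n%:R = half_angle k *+ 2 :> R.
  by rewrite /half_angle; ring.
rewrite /chord /ngon_vertex /= !double !cos_mulr2n !sin_mulr2n.
rewrite -[RHS]ger0_norm ?mulr_ge0 // -sqrtr_sqr; congr Num.sqrt.
rewrite /t sinB.
have := sin2cos2 (half_angle i); have := sin2cos2 (half_angle j).
set u := cos _; set v := sin _; set u' := cos _; set v' := sin _.
move=> hv hv'; ring: hv hv'.
Qed.

Lemma chord_gt0 i j : i != j -> 0 < chord i j.
Proof.
wlog ltij : i j / (i < j)%N => [hw ij|_].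
  have : (i < j)%N || (j < i)%N by rewrite -neq_ltn.
  by case/orP => h; [|rewrite chordC]; apply: hw; rewrite // eq_sym.
by rewrite chordE 1?ltnW // mulr_gt0 // sin_gt0_pi // half_angle_sub_itv.
Qed.

Lemma chord_ge0 i j : 0 <= chord i j.
Proof. by rewrite /chord; case: (_ - _) => u v; apply: sqrtr_ge0. Qed.

Definition ptolemy a b c d :=
  chord a c * chord b d = chord a b * chord c d + chord b c * chord d a.

Lemma ptolemy_rot a b c d : ptolemy a b c d -> ptolemy b c d a.
Proof. by rewrite /ptolemy (chordC c a); lra. Qed.

Lemma ptolemy_swap13 a b c d : ptolemy a b c d -> ptolemy c b a d.
Proof.
rewrite /ptolemy (chordC c a) (chordC c b) (chordC b a).
rewrite (chordC d a) (chordC d c).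
lra.
Qed.

Lemma ptolemy_swap24 a b c d : ptolemy a b c d -> ptolemy a d c b.
Proof.
by move=> /ptolemy_rot /ptolemy_swap13 /ptolemy_rot /ptolemy_rot /ptolemy_rot.
Qed.

Lemma ptolemy_sorted x y z w : (x <= y)%N -> (y <= z)%N -> (z <= w)%N ->
  ptolemy x y z w.
Proof.
move=> xy yz zw; have xz := leq_trans xy yz; have yw := leq_trans yz zw.
rewrite /ptolemy (chordC w) !chordE ?(leq_trans xy) // !sinB.
ring.
Qed.

Lemma ptolemy_unnested a b c d : (a <= c)%N -> (c < b)%N -> (b <= d)%N ->
  ~ ptolemy a b c d.
Proof.
move=> ac cb bd; have := ptolemy_sorted ac (ltnW cb) bd.
have : 0 < chord a d * chord c b.
  by rewrite mulr_gt0 // chord_gt0 // -val_eqE /=; lia.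
have : 0 <= chord a b * chord c d by rewrite mulr_ge0 ?chord_ge0.
rewrite /ptolemy (chordC b c) (chordC d a); nra.
Qed.

Lemma ptolemy_nested a b c d : (b < a)%N -> (a <= c)%N -> (c < d)%N ->
  ~ ptolemy a b c d.
Proof.
move=> ba ac cd; have := ptolemy_sorted (ltnW ba) ac (ltnW cd).
have : 0 < chord b a * chord c d.
  by rewrite mulr_gt0 // chord_gt0 // -val_eqE /=; lia.
have : 0 <= chord b c * chord a d by rewrite mulr_ge0 ?chord_ge0.
rewrite /ptolemy (chordC a b) (chordC d a) (chordC d b); nra.
Qed.

Lemma surrounds_not_ptolemy (A B : {set 'I_n}) a b c d :
  surrounds B A -> a \in A -> b \in B -> c \in A -> d \in B ->
  ~ ptolemy a b c d.
Proof.
move=> [B' [B'' [-> _ ltB'A ltAB'']]] aA bB cA dB.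
wlog ac : a c aA cA / (a <= c)%N => [hw|].
  case: (leqP a c) => [|/ltnW] h; first exact: hw.
  by move=> /ptolemy_swap13; apply: hw.
wlog bd : b d bB dB / (b <= d)%N => [hw|].
  case: (leqP b d) => [|/ltnW] h; first exact: hw.
  by move=> /ptolemy_swap24; apply: hw.
move: bB dB; rewrite !inE => /orP[bB|bB] /orP[dB|dB].
- move=> /ptolemy_rot /ptolemy_swap24; apply: ptolemy_unnested => //.
  exact: ltB'A.
- by apply: ptolemy_nested => //; [apply: ltB'A|apply: ltAB''].
- by have := ltAB'' _ _ aA bB; have := ltB'A _ _ dB aA => *; lia.
- by apply: ptolemy_unnested => //; apply: ltAB''.
Qed.

Lemma surrounds_of_not_between (A B : {set 'I_n}) : [disjoint A & B] ->
  (forall a b c, a \in A -> b \in B -> c \in A -> ~ (a < b < c)%N) ->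
  surrounds B A.
Proof.
move=> dAB nbetween; pose L := [set b in B | [forall a in A, (b < a)%N]].
exists L, (B :\: L); split.
- apply/setP => b; rewrite !inE.
  by case: (b \in B); rewrite ?andbF //= andbT orbN.
- rewrite -setI_eq0; apply/eqP/setP => b; rewrite !inE.
  by case: (b \in B); rewrite ?andbF //= andbT andbN.
- by move=> b a; rewrite inE => /andP[_ /forall_inP]; apply.
move=> c b cA; rewrite !inE => /andP[+ bB]; rewrite bB /=.
move=> /forall_inPn[a aA]; rewrite -leqNgt => leab.
have neq x : x \in A -> x != b :> nat.
  move=> xA; apply/eqP => /val_inj xb; move: (disjointFr dAB xA).
  by rewrite xb bB.
have ltab : (a < b)%N by rewrite ltn_neqAle neq.
rewrite ltn_neqAle neq //= leqNgt; apply/negP => ltbc.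
by apply: (nbetween a b c) => //; rewrite ltab.
Qed.

Lemma weakly_separatedP (I J : {set 'I_n}) :
  weakly_separated I J <->
  (forall a b c d, a \in I :\: J -> b \in J :\: I -> c \in I :\: J ->
     d \in J :\: I -> ~ ptolemy a b c d).
Proof.
split=> [[sep|sep] a b c d aA bB cA dB|noP].
- exact: (surrounds_not_ptolemy sep).
- by move=> /ptolemy_rot; apply: (surrounds_not_ptolemy sep).
have dIJ : [disjoint I :\: J & J :\: I].
  rewrite -setI_eq0; apply/eqP/setP => x; rewrite !inE.
  by case: (x \in I); rewrite ?andbF.
case: (pselect (exists a b c, [/\ a \in I :\: J, b \in J :\: I, c \in I :\: J
                                & (a < b < c)%N])) => [|nbetween]; last first.
  left; apply: surrounds_of_not_between => // a b c aA bB cA abc.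
  by apply: nbetween; exists a, b, c.
move=> [a [b [c [aA bB cA /andP[ab bc]]]]]; right.
apply: surrounds_of_not_between; first by rewrite disjoint_sym.
move=> b1 a1 b2 b1B a1A b2B /andP[ba ab2].
have b2c : (b2 <= c)%N.
  rewrite leqNgt; apply/negP => /ltnW cb2; apply: (noP a b c b2) => //.
  by apply: ptolemy_sorted => //; apply: ltnW.
have ab1 : (a <= b1)%N.
  rewrite leqNgt; apply/negP => /ltnW b1a; apply: (noP a b c b1) => //.
  by apply: ptolemy_rot; apply: ptolemy_sorted => //; apply: ltnW.
by apply: (noP a b1 a1 b2) => //; apply: ptolemy_sorted; rewrite // ltnW.
Qed.

Lemma chord_dihedral (g : 'S_n) i j : g \in dihedral R n ->
  chord (g i) (g j) = chord i j.
Proof.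
rewrite inE => /asboolP[f fI fg]; rewrite /chord -!fg.
by have [] := fI (ngon_vertex R i) (ngon_vertex R j).
Qed.

End Chords.

Theorem proposition4 (R : realType) (n k : nat) (hk1 : 1 <= k) (hkn : k <= n)
    (I J : {set 'I_n}) (hI : #|I| = k) (hJ : #|J| = k)
    (hIJ : weakly_separated I J) (g : 'S_n) (hg : g \in dihedral R n) :
  weakly_separated (g @: I) (g @: J).
Proof.
apply/(weakly_separatedP R) => a b c d.
have imD (A B : {set 'I_n}) : g @: A :\: g @: B = g @: (A :\: B).
  apply/setP => x; rewrite -(permKV g x) !inE.
  by rewrite !(mem_imset _ _ (@perm_inj _ g)) !inE.
rewrite !imD => /imsetP[a' aA ->] /imsetP[b' bB ->] /imsetP[c' cA ->].
move=> /imsetP[d' dB ->]; rewrite /ptolemy !chord_dihedral //.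
by move/(weakly_separatedP R): hIJ; apply.
Qed.
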